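(* $A_o^*(n)$ is equal to the quotient of $A_o(n)$ by the closed ideal generated by the relations $abc=cba$, one for each choice of $a,b,c\in\{u_{ij}: i,j=1,\dots,n\}$.
   Context: $A_o(n)$ is the universal $C^*$-algebra generated by self-adjoint elements $u_{ij}$ ($1\le i,j\le n$) such that $u=(u_{ij})$ satisfies $uu^t=u^tu=1$. $P(k,l)$ is the set of partitions of a set of $k$ upper points labelled $1,\dots,k$ and $l$ lower points labelled $1,\dots,l$. Two blocks $\{a,b\},\{c,d\}$ of a pairing cross if, listing the points in the cyclic order upper $1,\dots,k$ then lower $l,\dots,1$ (with $a<b$, $c<d$), one has $a<c<b<d$ or $c<a<d<b$. $P_o^*(k,l)$ is the set of pairings in $P(k,l)$ in which each block crosses an even number of other blocks. For $p\in P(k,l)$, $T_p:(\mathbb C^n)^{\otimes k}\to(\mathbb C^n)^{\otimes l}$ is $T_p(e_{i_1}\otimes\dots\otimes e_{i_k})=\sum_j\delta_p(i,j)e_{j_1}\otimes\dots\otimes e_{j_l}$, with $\delta_p(i,j)=1$ if points in the same block carry equal labels (upper point $r$ labelled $i_r$, lower point $s$ labelled $j_s$) and $0$ otherwise. $A_o^*(n)$ is the quotient of $A_o(n)$ by the closed ideal generated by the entries of $(T_p\otimes1)u^{\otimes k}-u^{\otimes l}(T_p\otimes1)$ for all $k,l$ and $p\in P_o^*(k,l)$, where $u^{\otimes k}$ is the $n^k\times n^k$ matrix with entries $u_{i_1j_1}\cdots u_{i_kj_k}$. *)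

(* Defs.v *)
(* mathcomp + mathcomp-reals (realType) + real_closed (complex). *)
From HB Require Import structures.
From mathcomp Require Import all_boot all_order all_algebra.
From mathcomp Require Import reals.
From mathcomp Require Import complex.
Set Implicit Arguments.
Unset Strict Implicit.
Unset Printing Implicit Defensive.
Import Order.TTheory GRing.Theory Num.Theory.
Local Open Scope ring_scope.
Local Open Scope complex_scope.

(* Unital C*-algebras over the complex numbers C := R[i], R : realType.     *)

Record CStarAlgebra (R : realType) := CStarAlgebra_mk {
  cs_carrier :> lalgType R[i];
  cs_star : cs_carrier -> cs_carrier;
  cs_norm : cs_carrier -> R;
  cs_starK : forall x, cs_star (cs_star x) = x;
  cs_starD : forall x y, cs_star (x + y) = cs_star x + cs_star y;
  cs_starZ : forall (c : R[i]) x, cs_star (c *: x) = (c^*)%C *: cs_star x;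
  cs_starM : forall x y, cs_star (x * y) = cs_star y * cs_star x;
  cs_norm_ge0 : forall x, 0 <= cs_norm x;
  cs_norm_eq0 : forall x, cs_norm x = 0 -> x = 0;
  cs_normD : forall x y, cs_norm (x + y) <= cs_norm x + cs_norm y;
  cs_normZ : forall (c : R[i]) x,
      (cs_norm (c *: x))%:C = `|c| * (cs_norm x)%:C;
  cs_normM : forall x y, cs_norm (x * y) <= cs_norm x * cs_norm y;
  cs_normC : forall x, cs_norm (cs_star x * x) = cs_norm x ^+ 2;
  cs_complete : forall u : nat -> cs_carrier,
      (forall e : R, 0 < e -> exists N, forall m k, (N <= m)%N -> (N <= k)%N ->
          cs_norm (u m - u k) < e) ->
      exists l, forall e : R, 0 < e -> exists N, forall m, (N <= m)%N ->
          cs_norm (u m - l) < e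
}.

(* Pairings in P(k,l).                                                       *)
(* The k+l points are encoded by 'I_(k+l): x < k is the upper point x+1,   *)
(* x >= k is the lower point (x-k)+1.  A pairing is a fixed-point-free     *)
(* involution p (block of x is {x, p x}).                                   *)

Definition is_pairing (k l : nat) (p : 'I_(k + l) -> 'I_(k + l)) : Prop :=
  forall x, p (p x) = x /\ p x != x.

(* position in the cyclic order upper 1..k, then lower l..1 (0-based) *)
Definition cyc_pos (k l : nat) (x : 'I_(k + l)) : nat :=
  if (x < k)%N then nat_of_ord x else (k + l - 1 - (x - k))%N.

(* blocks {a,b} and {c,d} cross *)
Definition cross_pos (a b c d : nat) : bool :=
  let a' := minn a b in let b' := maxn a b in
  let c' := minn c d in let d' := maxn c d in
  ((a' < c') && (c' < b') && (b' < d'))%N || ((c' < a') && (a' < d') && (d' < b'))%N.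

Definition blocks_cross (k l : nat) (p : 'I_(k + l) -> 'I_(k + l)) (x y : 'I_(k + l))
  : bool :=
  cross_pos (cyc_pos x) (cyc_pos (p x)) (cyc_pos y) (cyc_pos (p y)).

(* number of blocks crossing the block of x: each block {y, p y} is counted
   once, via its representative with the smaller cyclic position *)
Definition n_crossings (k l : nat) (p : 'I_(k + l) -> 'I_(k + l)) (x : 'I_(k + l))
  : nat :=
  #|[set y : 'I_(k + l) | (cyc_pos y < cyc_pos (p y))%N && blocks_cross p x y]|.

(* P_o^*(k,l) *)
Definition in_Po_star (k l : nat) (p : 'I_(k + l) -> 'I_(k + l)) : Prop :=
  is_pairing p /\ forall x, ~~ odd (n_crossings p x).

(* delta_p(i,j): upper point r carries i_r, lower point s carries j_s *)
Definition pt_label (n k l : nat) (i : 'I_k -> 'I_n) (j : 'I_l -> 'I_n)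
  (x : 'I_(k + l)) : 'I_n :=
  match split x with inl r => i r | inr s => j s end.

Definition delta_p (n k l : nat) (p : 'I_(k + l) -> 'I_(k + l))
  (i : 'I_k -> 'I_n) (j : 'I_l -> 'I_n) : bool :=
  [forall x, pt_label i j x == pt_label i j (p x)].

(* Relations on a matrix u = (u_ij) with entries in a C*-algebra.           *)

Section Rel.
Variables (R : realType) (B : CStarAlgebra R) (n : nat).
Implicit Type u : 'I_n -> 'I_n -> B.

(* the defining relations of A_o(n): self-adjoint entries and u u^t = u^t u = 1 *)
Definition Ao_relations u : Prop :=
  (forall i j, cs_star (u i j) = u i j) /\
  (forall i j, \sum_(m < n) u i m * u j m = (i == j)%:R) /\
  (forall i j, \sum_(m < n) u m i * u m j = (i == j)%:R).

(* (u^{(x)k})_{a,b} = u_{a_1 b_1} ... u_{a_k b_k} *)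
Definition tens_pow (k : nat) u (a b : {ffun 'I_k -> 'I_n}) : B :=
  \prod_(r < k) u (a r) (b r).

(* entries of (T_p (x) 1) u^{(x)k} - u^{(x)l} (T_p (x) 1) vanish *)
Definition intertwines (k l : nat) (p : 'I_(k + l) -> 'I_(k + l)) u : Prop :=
  forall (j : {ffun 'I_l -> 'I_n}) (i : {ffun 'I_k -> 'I_n}),
    \sum_(i' : {ffun 'I_k -> 'I_n}) (delta_p p i' j)%:R * tens_pow u i' i =
    \sum_(j' : {ffun 'I_l -> 'I_n}) tens_pow u j j' * (delta_p p i j')%:R.

(* abc = cba for all a, b, c in {u_ij} *)
Definition half_commutes u : Prop :=
  forall i1 j1 i2 j2 i3 j3,
    u i1 j1 * u i2 j2 * u i3 j3 = u i3 j3 * u i2 j2 * u i1 j1.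

End Rel.

(* Main.v *)
Require Import Defs.
From HB Require Import structures.
From mathcomp Require Import all_boot all_order all_algebra.
From mathcomp Require Import reals.
From mathcomp Require Import complex.
From mathcomp Require Import zify.
Import GRing.Theory.
Local Open Scope ring_scope.

(** The number of blocks crossing the block {a, b} has the parity of the number
    of points strictly between a and b, so P_o^* consists of the pairings whose
    blocks join points of opposite parity in the cyclic order.

    If abc = cba on the entries, the even letters of a word can be permuted freely
    without changing the product.  For p in P_o^*, moving the mate of each odd
    position next to it and summing over labellings compatible with p collapses
    the word by orthogonality, so the vector given by p is fixed; multiplying by
    u^{(x)l} and cancelling the lower part of the word turns this into the
    intertwining relation for p.

    Conversely, the pairing of P(3,3) joining upper r to lower 4 - r is in P_o^*,
    and its intertwining relation is abc = cba. *)

Lemma sum_involution_pairs (m : nat) (p : 'I_m -> 'I_m) (F : 'I_m -> nat) :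
  (forall x, p (p x) = x /\ p x != x) ->
  (\sum_x F x = \sum_(x : 'I_m | x < p x) (F x + F (p x)))%N.
Proof.
move=> hp; rewrite big_split /= (bigID (fun x : 'I_m => x < p x)%N) /=.
congr (_ + _)%N; rewrite (reindex p) /=; last first.
  by exists p => x _; case: (hp x).
apply: eq_bigl => x; case: (hp x) => -> /eqP hx.
have : nat_of_ord (p x) <> x by move/ord_inj.
by lia.
Qed.

Lemma fixpoint_free_involution_even (m : nat) (p : 'I_m -> 'I_m) :
  (forall x, p (p x) = x /\ p x != x) -> ~~ odd m.
Proof.
move=> hp; have := sum_involution_pairs m p (fun=> 1%N) hp.
by rewrite sum_nat_const card_ord muln1 sum_nat_const => ->; rewrite muln2 odd_double.
Qed.

Lemma cross_pos_betweenE (a b y z : nat) :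
    a <> b -> y <> z -> (a = y <-> b = z) -> (a = z <-> b = y) -> (y < z)%N ->
  cross_pos a b y z =
    (minn a b < y < maxn a b)%N (+) (minn a b < z < maxn a b)%N.
Proof. by rewrite /cross_pos; lia. Qed.

Lemma count_between (m a b : nat) :
  (b <= m)%N -> (\sum_(y < m) (a < y < b) = b.-1 - a)%N.
Proof.
move=> hb; elim: m b hb => [|m IH] b hb; first by rewrite big_ord0; lia.
rewrite big_ord_recr /=; have [hbm|hbm] := leqP b m; first by rewrite IH //; lia.
have -> : b = m.+1 by lia.
have -> : (\sum_(y < m) (a < y < m.+1) = \sum_(y < m) (a < y < m))%N.
  by apply: eq_bigr => y _; have := ltn_ord y; lia.
by rewrite IH //; lia.
Qed.

(* Strictly between the ends of the block of x, the blocks not crossing it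
   contribute zero or two points each, and those crossing it exactly one. *)
Lemma odd_crossings (m : nat) (p : 'I_m -> 'I_m) (x : 'I_m) :
    (forall y, p (p y) = y /\ p y != y) ->
  odd #|[set y : 'I_m | (y < p y)%N && cross_pos x (p x) y (p y)]| =
    ~~ odd (x + p x).
Proof.
move=> hp; set a := minn x (p x); set b := maxn x (p x).
have neq y : nat_of_ord y <> p y.
  by case: (hp y) => _ /eqP h /ord_inj /esym.
have -> : ~~ odd (x + p x) = odd (\sum_(y < m) (a < y < b)).
  by rewrite count_between; have := neq x; have := ltn_ord x; have := ltn_ord (p x);
    rewrite /a /b; lia.
rewrite (sum_involution_pairs _ p) // -sum1dep_card big_mkcondr /=.
rewrite !(big_morph odd oddD (erefl _)); apply: eq_bigr => y hy.
have inj (z t : 'I_m) : z = t :> nat <-> p z = p t :> nat.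
  split=> [/ord_inj -> //|/ord_inj e].
  by rewrite -(proj1 (hp z)) e (proj1 (hp t)).
rewrite oddD !oddb; apply: cross_pos_betweenE => //.
by rewrite inj (proj1 (hp y)).
Qed.

(* [cyc_pos] as a permutation of the points: it reverses the lower ones, hence is
   its own inverse. *)
Definition cyc_pt {k l : nat} (x : 'I_(k + l)) : 'I_(k + l) :=
  match split x with inl r => lshift l r | inr s => rshift k (rev_ord s) end.

Lemma cyc_pt_lshift (k l : nat) (r : 'I_k) : cyc_pt (lshift l r) = lshift l r.
Proof. by rewrite /cyc_pt (unsplitK (inl r)). Qed.

Lemma cyc_pt_rshift (k l : nat) (s : 'I_l) :
  cyc_pt (rshift k s) = rshift k (rev_ord s).
Proof. by rewrite /cyc_pt (unsplitK (inr s)). Qed.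

Lemma val_cyc_pt (k l : nat) (x : 'I_(k + l)) : cyc_pt x = cyc_pos x :> nat.
Proof.
rewrite -(splitK x) /cyc_pos; case: (split x) => r.
  by rewrite cyc_pt_lshift /= ltn_ord.
rewrite cyc_pt_rshift /= ltnNge leq_addr /=; by have := ltn_ord r; lia.
Qed.

Lemma cyc_ptK (k l : nat) : involutive (@cyc_pt k l).
Proof.
move=> x; rewrite -(splitK x); case: (split x) => r /=.
  by rewrite !cyc_pt_lshift.
by rewrite !cyc_pt_rshift rev_ordK.
Qed.

Lemma pt_label_lshift (n k l : nat) (i : 'I_k -> 'I_n) (j : 'I_l -> 'I_n) r :
  pt_label i j (lshift l r) = i r.
Proof. by rewrite /pt_label (unsplitK (inl r)). Qed.

Lemma pt_label_rshift (n k l : nat) (i : 'I_k -> 'I_n) (j : 'I_l -> 'I_n) s :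
  pt_label i j (rshift k s) = j s.
Proof. by rewrite /pt_label (unsplitK (inr s)). Qed.

Lemma conj_cyc_pt_pairing (k l : nat) (p : 'I_(k + l) -> 'I_(k + l)) :
  is_pairing p -> is_pairing (cyc_pt \o p \o cyc_pt).
Proof.
move=> hp y; rewrite /= cyc_ptK; case: (hp (cyc_pt y)) => -> hy.
split; first exact: cyc_ptK.
by rewrite -(inj_eq (inv_inj (cyc_ptK k l))) cyc_ptK.
Qed.

Lemma odd_n_crossings (k l : nat) (p : 'I_(k + l) -> 'I_(k + l)) x :
  is_pairing p -> odd (n_crossings p x) = ~~ odd (cyc_pos x + cyc_pos (p x)).
Proof.
move=> hp; have := odd_crossings _ _ (cyc_pt x) (conj_cyc_pt_pairing _ _ _ hp).
rewrite /= cyc_ptK !val_cyc_pt => <-; congr odd.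
rewrite /n_crossings -(card_imset _ (inv_inj (cyc_ptK k l))); apply: eq_card => y.
rewrite -[y in LHS]cyc_ptK mem_imset; last exact: inv_inj (cyc_ptK k l).
by rewrite !inE /blocks_cross -!val_cyc_pt !cyc_ptK.
Qed.

Lemma prod_zip_move_front (A : pzRingType) (T S : Type) (f : T -> A) (g : S -> A)
    (a : T) (s1 s2 : seq T) (y : S) (r : seq S) :
    (forall x y x', f x * g y * f x' = f x' * g y * f x) ->
    size (s1 ++ s2) = size r ->
  \prod_(q <- zip (s1 ++ a :: s2) (y :: r)) (f q.1 * g q.2) =
  \prod_(q <- zip (a :: s1 ++ s2) (y :: r)) (f q.1 * g q.2).
Proof.
move=> fgf; elim: s1 y r => [//|x s1 IH] y [//|z r] /= [hs].
have := IH z r hs; rewrite /= !big_cons /= => ->.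
by rewrite !mulrA fgf.
Qed.

Lemma prod_natr_bool (A : pzRingType) (I : finType) (b : I -> bool) :
  \prod_i (b i)%:R = [forall i, b i]%:R :> A.
Proof.
rewrite -(big_morph (GRing.natmul 1) (@natrM A) (mulr1n 1)); congr (_%:R).
case: forallP => [e|/forallP]; first by rewrite big1 // => i _; rewrite e.
by rewrite negb_forall => /existsP[i /negbTE e]; rewrite (bigD1 i) //= e mul0n.
Qed.

Lemma prod_zip_perm (A : pzRingType) (T : eqType) (S : Type) (f : T -> A)
    (g : S -> A) (s t : seq T) (r : seq S) :
    (forall x y x', f x * g y * f x' = f x' * g y * f x) ->
    perm_eq s t -> size s = size r ->
  \prod_(q <- zip s r) (f q.1 * g q.2) = \prod_(q <- zip t r) (f q.1 * g q.2).
Proof.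
move=> fgf; elim: s t r => [|x s IH] t r.
  by rewrite perm_sym => /perm_nilP ->.
move=> st; have /path.splitPr tx : x \in t by rewrite -(perm_mem st) mem_head.
case: tx st => t1 t2; rewrite perm_sym -cat1s perm_catCA perm_cons perm_sym => st.
case: r => [//|y r] [hs].
rewrite prod_zip_move_front //; last by rewrite -(perm_size st).
by rewrite /= !big_cons /= (IH _ _ st hs).
Qed.

Lemma prod_reindex_left (A : pzRingType) (h : nat) (f g : 'I_h -> A)
    (s : 'I_h -> 'I_h) :
    (forall x y x', f x * g y * f x' = f x' * g y * f x) -> injective s ->
  \prod_(i < h) (f (s i) * g i) = \prod_(i < h) (f i * g i).
Proof.
move=> fgf s_inj; set e := index_enum _.
have s_perm : perm_eq (map s e) e.
  apply: uniq_perm; rewrite ?(map_inj_uniq s_inj) ?index_enum_uniq // => i.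
  rewrite mem_index_enum; apply/mapP.
  by exists (invF s_inj i); rewrite ?mem_index_enum ?f_invF.
have zE (t : 'I_h -> 'I_h) : zip (map t e) e = [seq (t i, i) | i <- e].
  by rewrite -[X in zip _ X](map_id e) zip_map.
have := prod_zip_perm _ _ _ f g _ _ e fgf s_perm (size_map _ _).
by have := zE id; rewrite map_id => ->; rewrite zE !big_map.
Qed.

Definition even_ord {h : nat} (i : 'I_h) : 'I_h.*2 :=
  Ordinal (etrans (ltn_double i h) (ltn_ord i)).

Definition odd_ord {h : nat} (i : 'I_h) : 'I_h.*2 :=
  Ordinal (etrans (ltn_Sdouble i h) (ltn_ord i)).

Lemma half_ord_subproof (h : nat) (q : 'I_h.*2) : (q./2 < h)%N.
Proof. by rewrite ltn_half_double. Qed.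

Definition half_ord {h : nat} (q : 'I_h.*2) : 'I_h := Ordinal (half_ord_subproof h q).

Lemma even_ordK (h : nat) : cancel (@even_ord h) half_ord.
Proof. by move=> i; apply: ord_inj; rewrite /= doubleK. Qed.

Lemma odd_ordK (h : nat) : cancel (@odd_ord h) half_ord.
Proof. by move=> i; apply: ord_inj; rewrite /= uphalf_double. Qed.

Lemma half_ordK (h : nat) (q : 'I_h.*2) :
  (if odd q then odd_ord (half_ord q) else even_ord (half_ord q)) = q.
Proof.
apply: ord_inj; have := odd_double_half q.
by case: (odd q) => /=; lia.
Qed.

Lemma prod_even_odd (A : pzRingType) (h : nat) (v : 'I_h.*2 -> A) :
  \prod_q v q = \prod_(i < h) (v (even_ord i) * v (odd_ord i)).
Proof.
pose w k := oapp v 1 (insub k).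
have wE (q : 'I_h.*2) : v q = w q by rewrite /w valK.
rewrite (eq_bigr (fun q : 'I_h.*2 => w q)) //.
under [RHS]eq_bigr => i _ do rewrite !wE /=.
elim: h {v wE} w => [|h IH] w; first by rewrite !big_ord0.
by rewrite doubleS !big_ord_recr /= IH mulrA.
Qed.

(* Half-commutation makes words invariant under permutations of their even
   positions, so the mates of the odd positions can be brought next to them. *)
Lemma sum_pairing_word (A : pzRingType) (n m : nat) (u : 'I_n -> 'I_n -> A)
    (p : 'I_m -> 'I_m) (g : 'I_m -> 'I_n) :
    (forall i1 j1 i2 j2 i3 j3,
      u i1 j1 * u i2 j2 * u i3 j3 = u i3 j3 * u i2 j2 * u i1 j1) ->
    (forall i j, \sum_(a < n) u a i * u a j = (i == j)%:R) ->
    (forall q, [/\ p (p q) = q, p q != q & odd (q + p q)]) ->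
  \sum_(f : {ffun 'I_m -> 'I_n})
      [forall q, f q == f (p q)]%:R * \prod_(q < m) u (f q) (g q) =
  [forall q, g q == g (p q)]%:R.
Proof.
move=> half_comm orth hp.
have m_even : m = m./2.*2.
  rewrite even_halfK //; apply: (@fixpoint_free_involution_even m p) => q.
  by case: (hp q).
move: (m./2) m_even => h m_even; subst m.
have ev_mate i : even_ord (half_ord (p (odd_ord i))) = p (odd_ord i).
  rewrite -[RHS]half_ordK; case: ifP => //.
  by have [_ _] := hp (odd_ord i); rewrite oddD /= odd_double => /negbTE ->.
pose s i := half_ord (p (odd_ord i)).
have pK q : p (p q) = q by case: (hp q).
have s_inj : injective s.
  move=> i j /(congr1 even_ord); rewrite !ev_mate => /(congr1 p).
  by rewrite !pK => /(congr1 half_ord); rewrite !odd_ordK.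
have pairE (T : eqType) (f : 'I_h.*2 -> T) :
    [forall q, f q == f (p q)] = [forall i, f (p (odd_ord i)) == f (odd_ord i)].
  apply/forallP/forallP => e q; first by rewrite eq_sym.
  rewrite -(half_ordK _ q); case: ifP => q_odd; first by rewrite eq_sym.
  have [_ _] := hp q; rewrite oddD q_odd /= => pq_odd.
  have := half_ordK _ (p q); rewrite pq_odd => pqE.
  by have := e (half_ord (p q)); have := half_ordK _ q; rewrite q_odd => ->;
    rewrite pqE pK.
rewrite pairE.
pose lift (c : {ffun 'I_h -> 'I_n}) : {ffun 'I_h.*2 -> 'I_n} :=
  [ffun q : 'I_h.*2 => c (half_ord (if odd q then q else p q))].
have liftE c i : (lift c (odd_ord i) = c i) * (lift c (p (odd_ord i)) = c i).
  by rewrite !ffunE /= odd_double /= -[p (odd_ord i)]ev_mate /= odd_double /=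
             ev_mate pK odd_ordK.
transitivity (\sum_(f : {ffun 'I_h.*2 -> 'I_n} | [forall q, f q == f (p q)])
    \prod_(q < h.*2) u (f q) (g q)).
  rewrite [RHS]big_mkcond; apply: eq_bigr => f _.
  by case: ifP => _; rewrite ?mul1r ?mul0r.
rewrite (reindex lift) /=; last first.
  exists (fun f => [ffun i => f (odd_ord i)]) => [c _|f /forallP fp].
    by apply/ffunP => i; rewrite ffunE liftE.
  apply/ffunP => q; rewrite !ffunE; have := half_ordK _ q.
  case: ifP => q_odd qE; first by rewrite qE.
  have [_ _] := hp q; rewrite oddD q_odd /= => pq_odd.
  by have := half_ordK _ (p q); rewrite pq_odd => ->; rewrite -(eqP (fp q)).
rewrite (eq_bigl xpredT) => [|c]; last first.
  by rewrite pairE; apply/forallP => i; rewrite !liftE.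
transitivity (\sum_(c : {ffun 'I_h -> 'I_n}) \prod_(i < h)
    (u (c i) (g (p (odd_ord i))) * u (c i) (g (odd_ord i)))).
  apply: eq_bigr => c _; rewrite prod_even_odd.
  rewrite -(@prod_reindex_left _ _ (fun i => u (lift c (even_ord i)) (g (even_ord i)))
              (fun i => u (lift c (odd_ord i)) (g (odd_ord i))) s) //.
  by apply: eq_bigr => i _; rewrite ev_mate !liftE.
rewrite -(bigA_distr_bigA (fun i a => u a (g (p (odd_ord i))) * u a (g (odd_ord i)))).
under eq_bigr => i _ do rewrite orth.
exact: prod_natr_bool.
Qed.

Definition ffun_cons {T : finType} {l : nat} (q : T * {ffun 'I_l -> T}) :
    {ffun 'I_l.+1 -> T} :=
  [ffun i => oapp q.2 q.1 (unlift ord0 i)].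

Lemma ffun_cons0 (T : finType) (l : nat) (q : T * {ffun 'I_l -> T}) :
  ffun_cons q ord0 = q.1.
Proof. by rewrite ffunE unlift_none. Qed.

Lemma ffun_consS (T : finType) (l : nat) (q : T * {ffun 'I_l -> T}) i :
  ffun_cons q (lift ord0 i) = q.2 i.
Proof. by rewrite ffunE liftK. Qed.

Lemma sum_ffun_recl (A : pzRingType) (T : finType) (l : nat)
    (F : {ffun 'I_l.+1 -> T} -> A) :
  \sum_f F f = \sum_(f : {ffun 'I_l -> T}) \sum_a F (ffun_cons (a, f)).
Proof.
rewrite exchange_big pair_bigA (reindex ffun_cons) /=; last first.
  exists (fun f => (f ord0, [ffun i => f (lift ord0 i)])) => [[a f] _|f _].
    by rewrite ffun_cons0; congr (_, _); apply/ffunP => i; rewrite ffunE ffun_consS.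
  apply/ffunP => i; case: (unliftP ord0 i) => [j|] ->.
    by rewrite ffun_consS ffunE.
  by rewrite ffun_cons0.
by apply: eq_bigr => [[]].
Qed.

(* The products cancel from the middle outwards. *)
Lemma sum_rev_word_word (A : pzRingType) (T : finType) (l : nat)
    (F G : 'I_l -> T -> A) (b : 'I_l -> bool) :
    (forall r, \sum_a F r a * G r a = (b r)%:R) ->
  \sum_(f : {ffun 'I_l -> T})
      (\prod_(r < l) F (rev_ord r) (f (rev_ord r))) * \prod_(r < l) G r (f r) =
  [forall r, b r]%:R.
Proof.
move=> hb; rewrite -prod_natr_bool.
elim: l F G b hb => [|l IH] F G b hb.
  rewrite [RHS]big_ord0 (eq_bigr (fun=> 1)) => [|f _]; last by rewrite !big_ord0 mul1r.
  by rewrite sumr_const card_ffun card_ord expn0.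
rewrite sum_ffun_recl [RHS]big_ord_recl.
under [LHS]eq_bigr => f _.
  under eq_bigr => a _.
    rewrite big_ord_recr big_ord_recl /=.
    have -> : rev_ord (@ord_max l) = ord0 by apply: ord_inj; rewrite /= subnn.
    rewrite ffun_cons0 /= mulrA -[_ * _ * G _ _]mulrA.
    under eq_bigr => r _.
      have -> : rev_ord (widen_ord (leqnSn l) r) = lift ord0 (rev_ord r).
        by apply: ord_inj; rewrite /= /bump; have := ltn_ord r; lia.
      rewrite ffun_consS /=; over.
    under [X in _ * _ * X]eq_bigr => r _ do rewrite ffun_consS /=.
    over.
  rewrite -mulr_suml -mulr_sumr hb mulr_natr mulrnAl -mulr_natl.
  over.
rewrite -mulr_sumr; congr (_ * _).
exact: (IH (fun r => F (lift ord0 r)) (fun r => G (lift ord0 r)) (fun r => b (lift ord0 r))).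
Qed.

Lemma sum_mulrn_eq (V : nmodType) (T : finType) (a : T) (F : T -> V) :
  \sum_x F x *+ (x == a) = F a.
Proof. by under eq_bigr => x _ do rewrite mulrb; rewrite -big_mkcond big_pred1_eq. Qed.

Definition cyc_word {T : finType} {k l : nat}
    (q : {ffun 'I_k -> T} * {ffun 'I_l -> T}) : {ffun 'I_(k + l) -> T} :=
  [ffun x => match split (cyc_pt x) with inl r => q.1 r | inr s => q.2 s end].

Lemma cyc_wordE (n k l : nat) (i : {ffun 'I_k -> 'I_n}) (j : {ffun 'I_l -> 'I_n}) x :
  cyc_word (i, j) x = pt_label i j (cyc_pt x).
Proof. by rewrite ffunE. Qed.

Lemma cyc_word_bij (T : finType) (k l : nat) : bijective (@cyc_word T k l).
Proof.
exists (fun f : {ffun 'I_(k + l) -> T} =>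
  ([ffun r => f (cyc_pt (lshift l r))], [ffun s => f (cyc_pt (rshift k s))])).
  move=> [i j]; congr (_, _); apply/ffunP => r; rewrite !ffunE cyc_ptK.
    by rewrite (unsplitK (inl r)).
  by rewrite (unsplitK (inr r)).
move=> f; apply/ffunP => x; rewrite ffunE -[in RHS](cyc_ptK _ _ x) -[in RHS](splitK (cyc_pt x)).
by case: (split _) => r; rewrite ffunE.
Qed.

Lemma delta_p_cyc_word (n k l : nat) (p : 'I_(k + l) -> 'I_(k + l))
    (i : {ffun 'I_k -> 'I_n}) (j : {ffun 'I_l -> 'I_n}) :
  delta_p p i j = [forall q, cyc_word (i, j) q ==
                             cyc_word (i, j) ((cyc_pt \o p \o cyc_pt) q)].
Proof.
apply/forallP/forallP => e q.
  by rewrite !cyc_wordE /= cyc_ptK.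
by have := e (cyc_pt q); rewrite !cyc_wordE /= !cyc_ptK.
Qed.

(* Bending the lower legs around turns a P_o^* intertwiner into a vector fixed
   by the transposed tensor power, read in the cyclic order. *)
Lemma sum_delta_cyclic (A : pzRingType) (n k l : nat) (u : 'I_n -> 'I_n -> A)
    (p : 'I_(k + l) -> 'I_(k + l)) (i : {ffun 'I_k -> 'I_n}) (j : {ffun 'I_l -> 'I_n}) :
    (forall i1 j1 i2 j2 i3 j3,
      u i1 j1 * u i2 j2 * u i3 j3 = u i3 j3 * u i2 j2 * u i1 j1) ->
    (forall i j, \sum_(a < n) u a i * u a j = (i == j)%:R) ->
    in_Po_star p ->
  \sum_(i' : {ffun 'I_k -> 'I_n}) \sum_(j' : {ffun 'I_l -> 'I_n})
      (delta_p p i' j')%:R * (\prod_(r < k) u (i' r) (i r) *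
        \prod_(s < l) u (j' (rev_ord s)) (j (rev_ord s))) =
  (delta_p p i j)%:R.
Proof.
move=> half_comm orth [hp even_cross].
have hp' q : let p' := cyc_pt \o p \o cyc_pt in
    [/\ p' (p' q) = q, p' q != q & odd (q + p' q)].
  case: (conj_cyc_pt_pairing _ _ _ hp q) => h1 h2; split=> //.
  have := even_cross (cyc_pt q); rewrite odd_n_crossings // negbK.
  by rewrite -!val_cyc_pt cyc_ptK.
rewrite [in RHS]delta_p_cyc_word -(sum_pairing_word _ _ _ u) // pair_bigA.
rewrite [RHS](reindex cyc_word) /=; last exact: onW_bij (cyc_word_bij _ _ _).
apply: eq_bigr => [[i' j']] _ /=; rewrite delta_p_cyc_word; congr (_ * _).
rewrite big_split_ord /=; congr (_ * _); apply: eq_bigr => r _.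
  by rewrite !cyc_wordE cyc_pt_lshift !pt_label_lshift.
by rewrite !cyc_wordE cyc_pt_rshift !pt_label_rshift.
Qed.

Lemma half_commutes_intertwines (R : realType) (B : CStarAlgebra R) (n k l : nat)
    (u : 'I_n -> 'I_n -> B) (p : 'I_(k + l) -> 'I_(k + l)) :
  Ao_relations u -> half_commutes u -> in_Po_star p -> intertwines p u.
Proof.
move=> [_ [orth orth_tr]] half_comm hp j i.
pose W (j' b : {ffun 'I_l -> 'I_n}) : B :=
  \prod_(s < l) u (j' (rev_ord s)) (b (rev_ord s)).
have cancel j' : \sum_b W j' b * tens_pow u j b = (j' == j)%:R.
  rewrite (sum_rev_word_word _ _ _ (fun r => u (j' r)) (fun r => u (j r))
             (fun r => j' r == j r)) => [|r]; last exact: orth.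
  congr (nat_of_bool _)%:R; apply/forallP/eqP => [e|-> //].
  by apply/ffunP => r; apply/eqP.
transitivity (\sum_(b : {ffun 'I_l -> 'I_n}) (delta_p p i b)%:R * tens_pow u j b); last first.
  by apply: eq_bigr => b _; rewrite mulr_natl mulr_natr.
under [RHS]eq_bigr => b _.
  rewrite -(sum_delta_cyclic _ _ _ _ u p i b half_comm orth_tr hp) mulr_suml.
  under eq_bigr => i' _ do rewrite mulr_suml.
  over.
rewrite exchange_big; apply: eq_bigr => i' _ /=; rewrite exchange_big /=.
under [RHS]eq_bigr => j' _.
  under eq_bigr => b _ do rewrite -!mulrA.
  rewrite -!mulr_sumr cancel mulrA mulr_natr; over.
by rewrite sum_mulrn_eq.
Qed.

Definition reversal_pairing (x : 'I_(3 + 3)) : 'I_(3 + 3) := rev_ord x.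

Lemma reversal_in_Po_star : in_Po_star reversal_pairing.
Proof.
have hp : is_pairing reversal_pairing.
  move=> x; split; first exact: rev_ordK.
  by apply/eqP => /(congr1 (@nat_of_ord _)) /=; have := ltn_ord x; lia.
split=> // x; rewrite odd_n_crossings // negbK /cyc_pos /=.
by have := ltn_ord x; case: ifP; case: ifP; lia.
Qed.

(* Equality of the two closed ideals of A_o(n), stated through the universal
   property: in every unital C*-algebra, for every n x n matrix u satisfying
   the relations of A_o(n), the P_o^* intertwining relations hold iff the
   half-commutation relations abc = cba hold.  See NOTES.md. *)
Theorem theorem6p9 (R : realType) (B : CStarAlgebra R) (n : nat)
    (u : 'I_n -> 'I_n -> B) :
  Ao_relations u ->
  ((forall (k l : nat) (p : 'I_(k + l) -> 'I_(k + l)),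
       in_Po_star p -> intertwines p u)
   <-> half_commutes u).
Proof.
move=> hu; split; last by move=> hc k l p; apply: half_commutes_intertwines.
move=> hP i1 j1 i2 j2 i3 j3.
pose i : {ffun 'I_3 -> 'I_n} := [ffun r : 'I_3 => nth j1 [:: j1; j2; j3] r].
pose j : {ffun 'I_3 -> 'I_n} := [ffun r : 'I_3 => nth i1 [:: i3; i2; i1] r].
have := hP 3 3 _ reversal_in_Po_star j i.
pose rev3 (f : {ffun 'I_3 -> 'I_n}) : {ffun 'I_3 -> 'I_n} := [ffun r : 'I_3 => f (rev_ord r)].
have deltaE (f g : {ffun 'I_3 -> 'I_n}) : delta_p reversal_pairing f g = (f == rev3 g).
  have revE (r : 'I_3) :
      reversal_pairing (lshift 3 r) = rshift 3 (rev_ord r) /\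
      reversal_pairing (rshift 3 r) = lshift 3 (rev_ord r).
    by split; apply: ord_inj; rewrite /=; have := ltn_ord r; lia.
  apply/forallP/eqP => [e|-> x].
    apply/ffunP => r; have /eqP := e (lshift 3 r).
    by rewrite (proj1 (revE r)) pt_label_lshift pt_label_rshift ffunE.
  rewrite -(splitK x); case: (split x) => r /=; case: (revE r) => revl revr.
    by rewrite revl pt_label_lshift pt_label_rshift ffunE.
  by rewrite revr pt_label_lshift pt_label_rshift ffunE rev_ordK.
have rev3K : involutive rev3 by move=> f; apply/ffunP => r; rewrite !ffunE rev_ordK.
under eq_bigr => i' _ do rewrite deltaE mulr_natl.
under [RHS]eq_bigr => j' _ do
  rewrite deltaE -(inj_eq (inv_inj rev3K)) rev3K eq_sym mulr_natr.
by rewrite !sum_mulrn_eq /tens_pow !big_ord_recl !big_ord0 !ffunE /= !mulr1 !mulrA.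
Qed.
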